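(* Let $(\mathbf{x}_t)_{t\ge 0}$ be computed by the Stochastic Unified Momentum algorithm (described in the context) with momentum factor $\beta\in[0,1)$, parameter $s\ge 0$, stepsizes $(\gamma_t)_{t\ge0}$ and deterministic initial point $\mathbf{x}_0\in\mathbb{R}^d$. Suppose that assumptions (A.1)-(A.5) listed in the context hold and that the stepsizes satisfy (A.6), i.e. $(\gamma_t)_{t\ge0}$ is a deterministic nonnegative sequence with $\sum_{t=0}^\infty\gamma_t=\infty$ and $\sum_{t=0}^\infty\gamma_t^{1+\alpha}<\infty$. Then $$\sum_{t=0}^\infty \gamma_t\,\mathbb{E}\Vert\nabla f(\mathbf{x}_t)\Vert^2\le C_0,$$ where $C_0<\infty$ is a constant depending on $f,\mathbf{x}_0,\beta,s,(\gamma_t),C,\sigma$ (dependence on $f$ includes dependence on its Hölder data $\alpha, A$).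
   Context: $\Vert\cdot\Vert$ is the Euclidean norm on $\mathbb{R}^d$. $f:\mathbb{R}^d\to\mathbb{R}$ is the cost function. $\mathbf{g}(\mathbf{x},\xi)$ is a stochastic first order oracle: $\mathbf{g}$ is a Borel measurable $\mathbb{R}^d$-valued function, and $\xi_0,\xi_1,\dots$ are random variables on a probability space $(\Omega,\mathcal{F},\mathbb{P})$ with which the oracle is queried; write $\mathbf{g}_t=\mathbf{g}(\mathbf{x}_t,\xi_t)$. Stochastic Unified Momentum algorithm: given $\beta\in[0,1)$, $s\ge0$, $(\gamma_t)_{t\ge0}$ and $\mathbf{x}_0\in\mathbb{R}^d$, put $\mathbf{y}_0^s=\mathbf{x}_0$ and for $t=0,1,2,\dots$ $$\mathbf{y}_{t+1}=\mathbf{x}_t-\gamma_t\mathbf{g}_t,\qquad \mathbf{y}_{t+1}^s=\mathbf{x}_t-s\gamma_t\mathbf{g}_t,\qquad \mathbf{x}_{t+1}=\mathbf{y}_{t+1}+\beta(\mathbf{y}_{t+1}^s-\mathbf{y}_t^s).$$ Assumptions: (A.1) $f$ is continuously differentiable and $f_*:=\inf_{\mathbf{x}}f(\mathbf{x})>-\infty$. (A.2) There exist $\alpha\in(0,1]$ and $A>0$ such that $\Vert\nabla f(\mathbf{x})-\nabla f(\mathbf{y})\Vert\le A\Vert\mathbf{x}-\mathbf{y}\Vert^\alpha$ for all $\mathbf{x},\mathbf{y}\in\mathbb{R}^d$. (A.3) $\mathbb{E}[\mathbf{g}(\mathbf{x},\xi)]=\nabla f(\mathbf{x})$ for all $\mathbf{x}\in\mathbb{R}^d$,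 for $\xi$ each of the $\xi_t$. (A.4) There exist positive constants $\sigma^2$ and $C$ such that $\mathbb{E}[\Vert\mathbf{g}(\mathbf{x},\xi)-\nabla f(\mathbf{x})\Vert^2]\le\sigma^2+C\Vert\nabla f(\mathbf{x})\Vert^2$ for all $\mathbf{x}\in\mathbb{R}^d$, for $\xi$ each of the $\xi_t$. (A.5) The random variables $\{\xi_t\}_{t\ge0}$ are independent of each other. (A.6) $(\gamma_t)_{t\ge0}$ is a deterministic nonnegative sequence with $\sum_{t}\gamma_t=\infty$ and $\sum_{t}\gamma_t^{1+\alpha}<\infty$, with $\alpha$ as in (A.2). *)

(* Defs.v *)
From HB Require Import structures.
From mathcomp Require Import all_boot all_order all_algebra finmap.
From mathcomp Require Import all_classical all_reals all_analysis.
Set Implicit Arguments.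
Unset Strict Implicit.
Unset Printing Implicit Defensive.
Import Order.TTheory GRing.Theory Num.Theory.
Import numFieldNormedType.Exports.
Local Open Scope classical_set_scope.
Local Open Scope ring_scope.

(* The library norm `|x| on 'rV[R]_d is the sup norm; it induces the same
   topology and differentiability as the Euclidean norm. *)
Definition norm2 (R : realType) (d : nat) (x : 'rV[R]_d) : R :=
  Num.sqrt (\sum_(i < d) x 0 i ^+ 2).

Definition grad (R : realType) (d : nat) (f : 'rV[R]_d -> R) (x : 'rV[R]_d) :
    'rV[R]_d :=
  \row_(i < d) 'D_(delta_mx 0 i) f x.

Definition continuously_differentiable (R : realType) (d : nat)
    (f : 'rV[R]_d -> R) : Prop :=
  (forall x, differentiable f x) /\ continuous (grad f).

(* 'rV[R]_d carries no measurable structure in the library: this is 'rV[R]_d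
   itself, equipped with the sigma-algebra generated by its open sets. *)
Definition borel_rV (R : realType) (d : nat) :=
  g_sigma_algebraType (@open 'rV[R]_d).

(* Measurability jointly in the point and in the random input. *)
Definition borel_oracle (R : realType) (d : nat) (dX : measure_display)
    (Xi : measurableType dX) (g : 'rV[R]_d -> Xi -> 'rV[R]_d) : Prop :=
  measurable_fun [set: borel_rV R d * Xi]
    ((fun p => g p.1 p.2) : borel_rV R d * Xi -> borel_rV R d).

(* Joint (not merely pairwise) independence. *)
Definition mutually_independent (R : realType) (dO dX : measure_display)
    (Omega : measurableType dO) (P : probability Omega R)
    (Xi : measurableType dX) (xi : nat -> {RV P >-> Xi}) : Prop :=
  forall (J : {fset nat}) (B : nat -> set Xi),
    (forall t, t \in J -> measurable (B t)) ->
    (P (\bigcap_(t in [set` J]) (xi t @^-1` B t)) =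
     \prod_(t <- J) P (xi t @^-1` B t))%E.

(* The pair (x_t, y_t^s) along one realization xi of the random inputs. *)
Fixpoint sum_state (R : realType) (d : nat) (Xi : Type)
    (g : 'rV[R]_d -> Xi -> 'rV[R]_d) (beta s : R) (gamma : nat -> R)
    (x0 : 'rV[R]_d) (xi : nat -> Xi) (t : nat) : 'rV[R]_d * 'rV[R]_d :=
  if t is t'.+1 then
    let: (x, ys) := sum_state g beta s gamma x0 xi t' in
    let gt := g x (xi t') in
    let y_next := x - gamma t' *: gt in
    let ys_next := x - (s * gamma t') *: gt in
    (y_next + beta *: (ys_next - ys), ys_next)
  else (x0, x0).

Definition sum_iterate (R : realType) (d : nat) (Xi : Type)
    (g : 'rV[R]_d -> Xi -> 'rV[R]_d) (beta s : R) (gamma : nat -> R)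
    (x0 : 'rV[R]_d) (xi : nat -> Xi) (t : nat) : 'rV[R]_d :=
  (sum_state g beta s gamma x0 xi t).1.

(* Main.v *)
From HB Require Import structures.
Require Import Defs.
From mathcomp Require Import all_boot all_order all_algebra finmap.
From mathcomp Require Import all_classical all_reals all_analysis.
From mathcomp Require Import measurable_realfun.
From mathcomp Require Import ring lra.
Set Implicit Arguments.
Unset Strict Implicit.
Unset Printing Implicit Defensive.
Import Order.TTheory GRing.Theory Num.Theory.
Import numFieldNormedType.Exports.
Local Open Scope classical_set_scope.
Local Open Scope ring_scope.

(* Write a = gamma_t^(1+alpha), z_t = (x_t - beta y_t^s) / (1 - beta) and
   v_t = x_t - y_t^s. Then z_{t+1} = z_t - gamma_t g_t / (1 - beta), while
   v_{t+1} = beta v_t - (1 - s(1-beta)) gamma_t g_t is contracted up to noise,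
   and x_t = z_t - beta/(1-beta) v_t. The Hoelder descent inequality along z_t
   produces the error gamma_t |v_t|^(2 alpha), which is at most |v_t|^2 + a as
   soon as gamma_t <= 1; the contraction of v_t absorbs |v_t|^2. So for
   L_t = f(z_t) - f_* + K |v_t|^2 the conditional drift satisfies
     E L_{t+1} + gamma_t E|grad f(x_t)|^2 / (2 (1-beta))
       <= E L_t + const * a * (1 + E|grad f(x_t)|^2),
   and a = o(gamma_t) lets the gradient term on the right be absorbed for t at
   least some T depending only on the data. Before T, a crude second moment
   recursion bounds everything. Conditioning on the past is a Tonelli argument:
   the state at time t is a function of xi_0, ..., xi_{t-1}, hence independent
   of xi_t. *)

(** * Borel measurability of vector-valued maps *)

(** Balls with rational centres and radii [1/(k+1)] form a countable base. Countability is what lets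
    a generated sigma-algebra be tested on these balls. *)
Lemma open_rV_bigcup_rat (R : realType) (n : nat) (U : set 'rV[R]_n) :
  open U ->
  U = \bigcup_(p in [set p : 'rV[rat]_n * nat |
                 ball (map_mx ratr p.1 : 'rV[R]_n) p.2.+1%:R^-1 `<=` U])
        ball (map_mx ratr p.1 : 'rV[R]_n) p.2.+1%:R^-1.
Proof.
move=> oU; apply/seteqP; split => [x Ux|x [p /= pU /pU]//].
have /nbhs_ballP[e /= e0 eU] : nbhs x U by exact: open_nbhs_nbhs.
(* With radius below [e / 2], a ball of the family that contains [x] stays inside the [e]-ball
   around [x]. *)
have [k ke] : exists k, k.+1%:R^-1 < e / 2.
  have [k kP] := ltr_add_invr (divr_gt0 e0 (ltr0Sn R 1)).
  by exists k; rewrite add0r in kP.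
pose r : R := k.+1%:R^-1.
have r0 : 0 < r by rewrite invr_gt0.
have /choice[c cP] : forall i, exists q : rat, ratr q \in `]x 0 i - r, x 0 i + r[.
  by move=> i; apply: rat_in_itvoo; lra.
have xc : ball (map_mx ratr (\row_i c i) : 'rV[R]_n) r x.
  split=> // i j; rewrite !mxE (ord1 i) /ball /= ltr_norml.
  by have := cP j; rewrite in_itv /= => /andP[? ?]; apply/andP; split; lra.
exists (\row_i c i, k) => //= y yc; apply: eU.
rewrite (splitr e).
apply: (ball_triangle (y := map_mx ratr (\row_i c i) : 'rV[R]_n)).
  by apply: ball_sym; apply: le_ball xc; exact: ltW.
by apply: le_ball yc; exact: ltW.
Qed.

Section borel_rV.
Context {R : realType} {n : nat}.

(** A ball of the sup norm is a finite intersection of conditions on single coordinates, and an open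
    set is a countable union of such balls. *)
Lemma measurable_fun_rV d (T : measurableType d) (F : T -> borel_rV R n) :
  (forall i, measurable_fun setT (fun x => (F x : 'rV[R]_n) 0 i)) ->
  measurable_fun setT F.
Proof.
move=> mF.
apply: (@measurability _ _ T (borel_rV R n) setT F (@open 'rV[R]_n)) => //.
move=> _ [U oU <-].
rewrite setTI (open_rV_bigcup_rat oU) preimage_bigcup bigcup_mkcond.
apply: countable_bigcupT_measurable => [|p]; first exact: countableP.
case: ifPn => // _; set r := _^-1.
rewrite (_ : _ @^-1` _ =
    \bigcap_(i in [set: 'I_n]) [set x | `|ratr (p.1 0 i) - F x 0 i| < r]).
  apply: fin_bigcap_measurable => // i _.
  rewrite (_ : [set _ | _] =
      setT `&` (fun x => F x 0 i) @^-1` (ball (ratr (p.1 0 i) : R) r)).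
    by apply: mF => //; exact: (open_measurable (ball_open _ _)).
  by rewrite setTI.
apply/seteqP; split => x /=.
  by move=> [_ xr] i _; have := xr 0 i; rewrite mxE.
move=> xr; split => [|i j]; first by rewrite invr_gt0.
by rewrite mxE (ord1 i); exact: xr.
Qed.

Lemma continuous_measurable_rV (h : 'rV[R]_n -> R) : continuous h ->
  measurable_fun [set: borel_rV R n] (h : borel_rV R n -> R).
Proof.
move=> /continuousP ch; apply: (measurability _ (RGenOpens.measurableE R)).
move=> _ [_ [a [b ->] <-]]; rewrite setTI; apply: sub_sigma_algebra.
exact/ch/interval_open.
Qed.

End borel_rV.

(** * Independence from the past *)

(** The product formula on rectangles identifies the law of [(X, Y)] with the product of the two
    laws, by uniqueness of the product measure. Tonelli then splits the integral, [w'] acting as an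
    independent copy of [w]. *)
Lemma ge0_integral_indep_pair (R : realType) (dO dS dX : measure_display)
    (Omega : measurableType dO) (P : probability Omega R)
    (S : measurableType dS) (Xi : measurableType dX)
    (X : {RV P >-> S}) (Y : {RV P >-> Xi}) (h : S * Xi -> \bar R) :
  (forall A B, measurable A -> measurable B ->
    P (X @^-1` A `&` Y @^-1` B) = P (X @^-1` A) * P (Y @^-1` B))%E ->
  measurable_fun setT h -> (forall z, 0 <= h z)%E ->
  (\int[P]_w h (X w, Y w) = \int[P]_w \int[P]_w' h (X w, Y w'))%E.
Proof.
move=> indep mh h0.
have mXY : measurable_fun setT (fun w => (X w, Y w)).
  by apply: measurable_fun_pair; exact: measurable_funP.
pose XY : {mfun Omega >-> (S * Xi)%type} :=
  HB.pack (fun w => (X w, Y w)) (isMeasurableFun.Build _ _ _ _ _ mXY).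
transitivity (\int[distribution P XY]_z h z)%E.
  by rewrite ge0_integral_distribution.
transitivity (\int[distribution P X \x distribution P Y]_z h z)%E.
  apply: eq_measure_integral => A mA _.
  apply/esym/product_measure_unique => //.
rewrite (fubini_tonelli1 h mh h0) ge0_integral_distribution//=; last 2 first.
- exact: measurable_fun_fubini_tonelli_F.
- by move=> x; exact: integral_ge0.
apply: eq_integral => w _; rewrite /fubini_F ge0_integral_distribution//.
exact: measurableT_comp.
Qed.

Section past.
Context {R : realType} {dO dX : measure_display} {Omega : measurableType dO}.
Context {P : probability Omega R} {Xi : measurableType dX}.
Variable xi : nat -> {RV P >-> Xi}.

(** A pi-system that generates the sigma-algebra of the inputs with index below [t]. *)
Definition past_cylinders (t : nat) : set (set Omega) :=
  [set E | exists2 B : nat -> set Xi, (forall k, measurable (B k)) &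
     E = \bigcap_(k in `I_t) (xi k @^-1` B k)].

Lemma measurable_past (t k : nat) : (k < t)%N ->
  measurable_fun [set: g_sigma_algebraType (past_cylinders t)] (xi k).
Proof.
move=> kt _ A mA; rewrite setTI; apply: sub_sigma_algebra.
exists (fun j => if j == k then A else setT).
  by move=> j; case: ifP.
apply/seteqP; split => [w /= Aw j jt /=|w /(_ k kt)/=]; last by rewrite eqxx.
by case: eqVneq => [->|].
Qed.

Lemma past_cylinders_measurable t : past_cylinders t `<=` measurable.
Proof.
move=> _ [B mB ->]; apply: fin_bigcap_measurable => [|k _]; first exact: finite_II.
by rewrite -[X in measurable X]setTI; exact: measurable_funP.
Qed.

Lemma past_indep (t : nat) (E : set Omega) (B : set Xi) :
  mutually_independent xi -> <<s past_cylinders t >> E -> measurable B ->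
  P (E `&` xi t @^-1` B) = (P E * P (xi t @^-1` B))%E.
Proof.
move=> indep sE mB.
have mxi k C : measurable C -> measurable (xi k @^-1` C).
  by move=> mC; rewrite -[X in measurable X]setTI; exact: measurable_funP.
have PB : P (xi t @^-1` B) \is a fin_num by apply: fin_num_measure; exact: mxi.
pose r : {nonneg R} := NngNum (fine_ge0 (measure_ge0 P (xi t @^-1` B))).
suff : mrestr P (mxi t _ mB) E = mscale r P E.
  by rewrite /mrestr /mscale /= fineK// muleC.
apply: (g_sigma_algebra_measure_unique (past_cylinders t) _ (fun=> setT)) => //.
- exact: past_cylinders_measurable.
- by move=> _; exists (fun=> setT) => //; rewrite bigcapT.
- by apply/seteqP; split => // w _; exists 0%N.
- move=> _ _ [B1 mB1 ->] [B2 mB2 ->]; exists (fun k => B1 k `&` B2 k).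
    by move=> k; exact: measurableI.
  by rewrite -bigcapI.
- move=> _ [C mC ->]; rewrite /= /mrestr /mscale /= fineK//.
  pose J := [fset k | k in iota 0 t]%fset.
  have JE : [set` J] = `I_t.
    by apply/seteqP; split => k /=; rewrite !inE/= mem_iota add0n.
  have tJ : t \notin J by rewrite !inE/= mem_iota add0n ltnn.
  pose C' k := if k == t then B else C k.
  have mC' k : measurable (C' k) by rewrite /C'; case: ifP.
  have C'J : \bigcap_(k in [set` J]) (xi k @^-1` C' k) =
      \bigcap_(k in `I_t) (xi k @^-1` C k).
    rewrite JE; apply: eq_bigcapr => k /= kt.
    by rewrite /C' (ltn_eqF kt).
  have := indep (t |` J)%fset C' (fun k _ => mC' k).
  rewrite big_fsetU1//= -(indep J C' (fun k _ => mC' k)) C'J.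
  rewrite /C' eqxx => <-; congr (P _).
  rewrite -{}C'J /C'; apply/seteqP; split => w /=.
    move=> [CJ Bt] k; rewrite /= !inE => /orP[/eqP ->|kJ]; first by rewrite eqxx.
    by apply: CJ; rewrite /= inE.
  move=> CJ; split; last by have := CJ t; rewrite /= fset1U1 eqxx; exact.
  by move=> k kJ; apply: CJ; rewrite /= fset1Ur.
- by move=> k; apply: fin_num_fun_lty; exact: fin_num_measure.
Qed.

End past.

(** * The update map *)

Section sum_update.
Context {R : realType} {n : nat}.

(** The oracle value is a separate argument [X], so that a fresh sample can be averaged out while
    the state stays frozen. *)
Definition sum_update (beta s c : R) (S : 'rV[R]_n * 'rV[R]_n) (X : 'rV[R]_n) :
    'rV[R]_n * 'rV[R]_n :=
  (S.1 - c *: X + beta *: (S.1 - (s * c) *: X - S.2), S.1 - (s * c) *: X).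

Lemma sum_stateS (Xi : Type) (g : 'rV[R]_n -> Xi -> 'rV[R]_n) beta s gamma x0
    (xi : nat -> Xi) t :
  sum_state g beta s gamma x0 xi t.+1 =
  sum_update beta s (gamma t) (sum_state g beta s gamma x0 xi t)
    (g (sum_iterate g beta s gamma x0 xi t) (xi t)).
Proof. by rewrite /sum_iterate /=; case: sum_state. Qed.

Local Notation state := (borel_rV R n * borel_rV R n)%type.

Lemma measurable_coord (i : 'I_n) :
  measurable_fun [set: borel_rV R n] (fun x : borel_rV R n => (x : 'rV[R]_n) 0 i).
Proof. by apply: continuous_measurable_rV; exact: coord_continuous. Qed.

Lemma measurable_sum_update (beta s c : R) :
  measurable_fun [set: state * borel_rV R n]
    ((fun p => sum_update beta s c p.1 p.2) : state * borel_rV R n -> state).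
Proof.
have m1 i : measurable_fun [set: state * borel_rV R n]
    (fun p : state * borel_rV R n => (p.1.1 : 'rV[R]_n) 0 i).
  by apply: (measurableT_comp (measurable_coord i)); apply: measurableT_comp.
have m2 i : measurable_fun [set: state * borel_rV R n]
    (fun p : state * borel_rV R n => (p.1.2 : 'rV[R]_n) 0 i).
  by apply: (measurableT_comp (measurable_coord i)); apply: measurableT_comp.
have m3 i : measurable_fun [set: state * borel_rV R n]
    (fun p : state * borel_rV R n => (p.2 : 'rV[R]_n) 0 i).
  by apply: (measurableT_comp (measurable_coord i)).
apply: measurable_fun_pair; apply: measurable_fun_rV => i.
  rewrite (_ : (fun _ => _) = fun p : state * borel_rV R n =>
     (p.1.1 : 'rV[R]_n) 0 i - c * (p.2 : 'rV[R]_n) 0 i +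
     beta * ((p.1.1 : 'rV[R]_n) 0 i - s * c * (p.2 : 'rV[R]_n) 0 i -
             (p.1.2 : 'rV[R]_n) 0 i)); last first.
    by apply/funext => p; rewrite /= !mxE.
  by repeat (apply: measurable_funB || apply: measurable_funD ||
             apply: measurable_funM).
rewrite (_ : (fun _ => _) = fun p : state * borel_rV R n =>
   (p.1.1 : 'rV[R]_n) 0 i - s * c * (p.2 : 'rV[R]_n) 0 i); last first.
  by apply/funext => p; rewrite /= !mxE.
by repeat (apply: measurable_funB || apply: measurable_funM).
Qed.

(** The space [T] is left open in order to serve twice: with the full sigma-algebra of [Omega], and
    with the one generated by the past. In the second case only the inputs before time [t] are
    measurable, which is all that the state depends on. *)
Lemma measurable_sum_state d (T : measurableType d) (dX : measure_display)
    (Xi : measurableType dX) (g : 'rV[R]_n -> Xi -> 'rV[R]_n) beta s gamma x0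
    (xi : nat -> T -> Xi) (t : nat) :
  borel_oracle g -> (forall k, (k < t)%N -> measurable_fun setT (xi k)) ->
  measurable_fun setT
    ((fun w => sum_state g beta s gamma x0 (xi ^~ w) t) : T -> state).
Proof.
move=> mg; elim: t => [_|t ih mxi]; first exact: measurable_cst.
rewrite (_ : (fun _ => _) = (fun w => sum_update beta s (gamma t)
    (sum_state g beta s gamma x0 (xi ^~ w) t)
    (g (sum_iterate g beta s gamma x0 (xi ^~ w) t) (xi t w)))); last first.
  by apply/funext => w; rewrite sum_stateS.
have mt : measurable_fun setT
    ((fun w => sum_state g beta s gamma x0 (xi ^~ w) t) : T -> state).
  by apply: ih => k kt; apply: mxi; exact: ltnW.
apply: (measurableT_comp (measurable_sum_update beta s (gamma t))
  (g := fun w => (sum_state g beta s gamma x0 (xi ^~ w) t : state,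
     g (sum_iterate g beta s gamma x0 (xi ^~ w) t) (xi t w) : borel_rV R n))).
apply: measurable_fun_pair => //.
apply: (measurableT_comp mg
  (g := fun w => (sum_iterate g beta s gamma x0 (xi ^~ w) t : borel_rV R n, xi t w))).
apply: measurable_fun_pair; last exact: mxi.
exact: (measurableT_comp measurable_fst mt).
Qed.

End sum_update.

(** * Euclidean geometry and the descent inequality *)

Section euclidean.
Context {R : realType} {n : nat}.
Implicit Types u v : 'rV[R]_n.

Definition dotv u v : R := \sum_(i < n) u 0 i * v 0 i.

Lemma norm2_ge0 u : 0 <= norm2 u. Proof. exact: sqrtr_ge0. Qed.

Lemma sqr_norm2 u : norm2 u ^+ 2 = \sum_(i < n) u 0 i ^+ 2.
Proof. by rewrite sqr_sqrtr// sumr_ge0// => i _; exact: sqr_ge0. Qed.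

Lemma norm2_eq0 u : norm2 u = 0 -> u = 0.
Proof.
move=> u0; have /psumr_eq0P : \sum_(i < n) u 0 i ^+ 2 = 0.
  by rewrite -sqr_norm2 u0 expr0n.
move=> h; apply/rowP => i; rewrite mxE; apply/eqP.
by rewrite -sqrf_eq0 h// => j _; exact: sqr_ge0.
Qed.

(** Cauchy-Schwarz: the vector [|v|^2 u - <u,v> v] has squared norm [|v|^2 (|u|^2 |v|^2 - <u,v>^2)],
    which is therefore nonnegative. *)
Lemma dotv_le_norm2 u v : dotv u v <= norm2 u * norm2 v.
Proof.
have [v0|v0] := eqVneq (norm2 v) 0.
  rewrite v0 mulr0 (norm2_eq0 v0) /dotv big1// => i _.
  by rewrite mxE mulr0.
have vp : 0 < norm2 v by rewrite lt_def v0 norm2_ge0.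
have [d0|d0] := leP (dotv u v) 0.
  by apply: le_trans d0 _; rewrite mulr_ge0// norm2_ge0.
rewrite -(@ler_pXn2r _ 2)// ?nnegrE ?mulr_ge0 ?norm2_ge0 ?(ltW d0)//.
have : 0 <= \sum_(i < n) (norm2 v ^+ 2 * u 0 i - dotv u v * v 0 i) ^+ 2.
  by apply: sumr_ge0 => i _; exact: sqr_ge0.
rewrite (_ : \sum_(i < n) _ = norm2 v ^+ 2 *
    ((norm2 u * norm2 v) ^+ 2 - dotv u v ^+ 2)).
  by rewrite pmulr_rge0 ?exprn_gt0// subr_ge0.
move DE : (dotv u v) => D.
transitivity (norm2 v ^+ 4 * (\sum_(i < n) u 0 i ^+ 2)
   - 2 * norm2 v ^+ 2 * D * (\sum_(i < n) u 0 i * v 0 i)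
   + D ^+ 2 * (\sum_(i < n) v 0 i ^+ 2)).
  by rewrite !mulr_sumr -sumrB -big_split; apply: eq_bigr => i _ /=; ring.
by rewrite -!sqr_norm2 -/(dotv u v) DE; ring.
Qed.

Lemma norm2N u : norm2 (- u) = norm2 u.
Proof. by congr Num.sqrt; apply: eq_bigr => i _; rewrite mxE sqrrN. Qed.

Lemma norm2Z (c : R) u : norm2 (c *: u) = `|c| * norm2 u.
Proof.
rewrite /norm2 -sqrtr_sqr -sqrtrM ?sqr_ge0// mulr_sumr.
by congr Num.sqrt; apply: eq_bigr => i _; rewrite mxE exprMn.
Qed.

Lemma sqr_norm2D_le u v : norm2 (u + v) ^+ 2 <= 2 * norm2 u ^+ 2 + 2 * norm2 v ^+ 2.
Proof.
rewrite !sqr_norm2 !mulr_sumr -big_split; apply: ler_sum => i _ /=.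
by rewrite mxE -subr_ge0 [X in 0 <= X](_ : _ = (u 0 i - v 0 i) ^+ 2) ?sqr_ge0//; ring.
Qed.

Lemma sqr_norm2B_le u v : norm2 (u - v) ^+ 2 <= 2 * norm2 u ^+ 2 + 2 * norm2 v ^+ 2.
Proof. by rewrite -(norm2N v); exact: sqr_norm2D_le. Qed.

(* Convexity of the square, applied to
   [beta * u + (1 - beta) * (- c * v / (1 - beta))]. *)
Lemma sqr_norm2_contraction (beta c : R) u v : 0 <= beta < 1 ->
  norm2 (beta *: u - c *: v) ^+ 2 <=
  beta * norm2 u ^+ 2 + c ^+ 2 / (1 - beta) * norm2 v ^+ 2.
Proof.
move=> /andP[b0 b1]; rewrite !sqr_norm2 !mulr_sumr -big_split; apply: ler_sum => i _ /=.
have b1' : 0 < 1 - beta by rewrite subr_gt0.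
rewrite !mxE -subr_ge0 [X in 0 <= X](_ : _ =
   beta / (1 - beta) * ((1 - beta) * u 0 i + c * v 0 i) ^+ 2).
  by rewrite mulr_ge0 ?sqr_ge0// divr_ge0// ltW.
by field; rewrite gt_eqF.
Qed.

Lemma sqr_norm2B_dotv u v :
  norm2 (u - v) ^+ 2 = norm2 u ^+ 2 - 2 * dotv u v + norm2 v ^+ 2.
Proof.
rewrite !sqr_norm2 mulr_sumr -sumrB -big_split; apply: eq_bigr => i _ /=.
by rewrite !mxE; ring.
Qed.

Lemma dotvBr u v w : dotv u (v - w) = dotv u v - dotv u w.
Proof. by rewrite /dotv -sumrB; apply: eq_bigr => i _; rewrite !mxE mulrBr. Qed.

Lemma dotvBl u v w : dotv (u - v) w = dotv u w - dotv v w.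
Proof. by rewrite /dotv -sumrB; apply: eq_bigr => i _; rewrite !mxE mulrBl. Qed.

Lemma dotvZr c u v : dotv u (c *: v) = c * dotv u v.
Proof. by rewrite /dotv mulr_sumr; apply: eq_bigr => i _; rewrite !mxE mulrCA. Qed.

Lemma dotvZl c u v : dotv (c *: u) v = c * dotv u v.
Proof. by rewrite /dotv mulr_sumr; apply: eq_bigr => i _; rewrite !mxE mulrA. Qed.

Lemma derive_dotv (f : 'rV[R]_n -> R) x h : differentiable f x ->
  'D_h f x = dotv (grad f x) h.
Proof.
move=> df; rewrite deriveE// [in LHS](row_sum_delta h) linear_sum /dotv.
apply: eq_bigr => i _; rewrite linearZ/= -deriveE// mxE.
by rewrite mulrC.
Qed.

(** The mean value theorem on the segment gives an increment [<grad f (z + c h), h>] with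
    [0 < c < 1]; the Hoelder condition and Cauchy-Schwarz compare it with [<grad f z, h>]. Using one
    intermediate point instead of an integral gives the constant [A] rather than
    [A / (1 + alpha)]. *)
Lemma holder_descent (f : 'rV[R]_n -> R) (alpha A : R) z h :
  (forall x, differentiable f x) -> 0 < alpha -> 0 < A ->
  (forall x y, norm2 (grad f x - grad f y) <= A * norm2 (x - y) `^ alpha) ->
  f (z + h) <= f z + dotv (grad f z) h + A * norm2 h `^ (1 + alpha).
Proof.
move=> df al0 A0 hf.
pose phi (r : R) := f (z + r *: h).
have dphi (r : R) : is_derive r (1 : R) phi (dotv (grad f (z + r *: h)) h).
  (* The difference quotients of [phi] at [r] are those of [f] at [z + r *: h] in direction [h]. *)
  have E : (fun k : R => k^-1 *: (phi (k *: 1 + r) - phi r)) =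
      (fun k => k^-1 *: (f (k *: h + (z + r *: h)) - f (z + r *: h))).
    apply/funext => k; rewrite /phi; do 2 f_equal; f_equal.
    by rewrite scalerDl addrCA [k *: 1]mulr1.
  apply: DeriveDef; first by rewrite /derivable E; exact: diff_derivable.
  by rewrite -derive_dotv// /derive E.
have cphi : {within `[0, 1], continuous phi}.
  apply: continuous_subspaceT => r; apply: differentiable_continuous.
  by apply/derivable1_diffP; have [] := dphi r.
have [c + +] := MVT ltr01 (fun r _ => dphi r) cphi.
rewrite in_itv/= => /andP[c0 c1].
rewrite /phi scale1r scale0r addr0 subr0 mulr1 => fE.
rewrite -addrA -lerBlDl fE -lerBlDl -dotvBl.
apply: le_trans (dotv_le_norm2 _ _) _.
rewrite powRD; last by rewrite gt_eqF// addr_gt0.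
rewrite powRr1 ?norm2_ge0// [X in _ <= A * X]mulrC mulrA.
apply: ler_wpM2r; first exact: norm2_ge0.
apply: le_trans (hf _ _) _; apply: ler_wpM2l; first exact: ltW.
rewrite addrAC subrr add0r norm2Z gtr0_norm//.
apply: ge0_ler_powR; rewrite ?nnegrE ?mulr_ge0 ?norm2_ge0 ?(ltW al0) ?(ltW c0)//.
by rewrite ler_piMl ?norm2_ge0// ltW.
Qed.

End euclidean.

(** * Expectation of a function with a quadratic upper bound *)

Lemma integral_probability_cst d (T : measurableType d) (R : realType)
    (P : probability T R) (c : R) : (\int[P]_w c%:E = c%:E)%E.
Proof.
by rewrite integral_cst// -[RHS]mule1; congr (_ * _)%E; exact: probability_setT.
Qed.

(** The linear term of the upper bound has mean zero because [X] has mean [m], and the quadratic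
    term has mean at most [c2 * V]. Both one-step estimates below are averaged through this
    lemma. *)
Lemma ge0_integral_moments_le (R : realType) (n : nat) (dO : measure_display)
    (Omega : measurableType dO) (P : probability Omega R)
    (X : Omega -> 'rV[R]_n) (m c1 : 'rV[R]_n) (V c0 c2 : R) (h : 'rV[R]_n -> R) :
  (forall i, P.-integrable setT (fun w => (X w 0 i)%:E)) ->
  (forall i, \int[P]_w (X w 0 i)%:E = (m 0 i)%:E)%E ->
  (\int[P]_w (norm2 (X w - m) ^+ 2)%:E <= V%:E)%E ->
  measurable_fun setT (fun w => h (X w)) -> (forall u, 0 <= h u) -> 0 <= c2 ->
  (forall u, h u <= c0 + dotv c1 (u - m) + c2 * norm2 (u - m) ^+ 2) ->
  (\int[P]_w (h (X w))%:E <= (c0 + c2 * V)%:E)%E.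
Proof.
move=> iX EX EQ mh h0 c20 hle.
have mX i : measurable_fun setT (fun w => X w 0 i).
  by apply/measurable_EFinP; exact: measurable_int (iX i).
have mQ : measurable_fun setT (fun w => norm2 (X w - m) ^+ 2).
  rewrite (_ : (fun _ => _) = fun w => \sum_i (X w 0 i - m 0 i) ^+ 2); last first.
    apply/funext => w; rewrite sqr_norm2; apply: eq_bigr => i _; by rewrite !mxE.
  by apply: measurable_sum => i; apply: measurable_funX; exact: measurable_funB.
have Q0 w : (0 <= (norm2 (X w - m) ^+ 2)%:E)%E by rewrite lee_fin sqr_ge0.
have iQ : P.-integrable setT (fun w => (norm2 (X w - m) ^+ 2)%:E).
  apply/integrableP; split; first exact/measurable_EFinP.
  under eq_integral do rewrite gee0_abs//.
  exact: le_lt_trans EQ (ltry _).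
pose D w := dotv c1 (X w - m).
have iDi i : P.-integrable setT (fun w => (c1 0 i * (X w - m) 0 i)%:E).
  under eq_fun do rewrite !mxE EFinM EFinB.
  apply: integrableZl => //; apply: integrableB => //.
  exact: finite_measure_integrable_cst.
have DE : (fun w => (D w)%:E) = (fun w => \sum_i (c1 0 i * (X w - m) 0 i)%:E)%E.
  by apply/funext => w; rewrite sumEFin.
have iD : P.-integrable setT (fun w => (D w)%:E).
  by rewrite DE; apply: integrable_sum.
have ED : (\int[P]_w (D w)%:E = 0)%E.
  rewrite DE integral_sum//; apply: big1 => i _.
  under eq_integral do rewrite !mxE EFinM EFinB.
  rewrite integralZl//; last first.
    by apply: integrableB => //; exact: finite_measure_integrable_cst.
  rewrite integralB//; last exact: finite_measure_integrable_cst.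
  by rewrite EX integral_probability_cst subee// mule0.
have ic : P.-integrable setT (fun w => c0%:E).
  exact: finite_measure_integrable_cst.
have icQ : P.-integrable setT (fun w => (c2%:E * (norm2 (X w - m) ^+ 2)%:E)%E).
  exact: integrableZl.
have icD : P.-integrable setT (fun w => (c0%:E + (D w)%:E)%E).
  exact: (integrableD measurableT ic iD).
have icDQ : P.-integrable setT
    (fun w => (c0%:E + (D w)%:E + c2%:E * (norm2 (X w - m) ^+ 2)%:E)%E).
  exact: (integrableD measurableT icD icQ).
apply: (@le_trans _ _ (\int[P]_w
    (c0%:E + (D w)%:E + c2%:E * (norm2 (X w - m) ^+ 2)%:E))%E).
  apply: ge0_le_integral => //.
  - by move=> w _; rewrite lee_fin.
  - exact/measurable_EFinP.
  - exact: measurable_int icDQ.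
  - by move=> w _; rewrite -EFinM -!EFinD lee_fin; exact: hle.
rewrite (integralD measurableT icD icQ) (integralD measurableT ic iD) ED.
rewrite adde0 integral_probability_cst integralZl//.
by rewrite EFinD leeD2l// EFinM lee_wpmul2l// lee_fin.
Qed.

(** * Drift of the Lyapunov function *)

Section powers.
Context {R : realType}.
Implicit Types r e c alpha : R.

Lemma powR_le1Dsqr r e : 0 <= r -> 0 <= e <= 2 -> r `^ e <= 1 + r ^+ 2.
Proof.
move=> r0 /andP[e0 e2]; have [r1|r1] := leP r 1.
  apply: (@le_trans _ _ (1 `^ e)); last by rewrite powR1 lerDl sqr_ge0.
  by apply: ge0_ler_powR; rewrite ?nnegrE.
apply: (@le_trans _ _ (r `^ 2%:R)); first by apply: ler_powR => //; exact: ltW.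
by rewrite powR_mulrn// lerDr.
Qed.

Lemma sqr_powR r e : 0 <= r -> (r `^ e) ^+ 2 = (r ^+ 2) `^ e.
Proof. by move=> r0; rewrite -powR_mulrn ?powR_ge0// powRAC powR_mulrn. Qed.

(* If [V] is below [c `^ (1 + alpha)] then the left-hand side is at most the
   second summand, as [c <= 1]; otherwise [c <= V `^ (1 - alpha)], as
   [(1 + alpha) * (1 - alpha) <= 1]. *)
Lemma weighted_powR_le c V alpha : 0 <= c <= 1 -> 0 < alpha <= 1 -> 0 <= V ->
  c * V `^ alpha <= V + c `^ (1 + alpha).
Proof.
move=> /andP[c0 c1] /andP[al0 al1] V0.
move: c0; rewrite le_eqVlt => /predU1P[<-|c0].
  by rewrite mul0r addr_ge0// powR_ge0.
have c01 : 0 < c <= 1 by rewrite c0.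
have [cV|cV] := leP (c `^ (1 + alpha)) V.
  apply: ler_wpDr; first exact: powR_ge0.
  have V0' : 0 < V by apply: lt_le_trans cV; exact: powR_gt0.
  rewrite -{2}(powRr1 V0) -[in X in _ <= X](subrK alpha 1) powRD; last first.
    by rewrite (gt_eqF V0') implybT.
  apply: ler_wpM2r; first exact: powR_ge0.
  apply: (@le_trans _ _ ((c `^ (1 + alpha)) `^ (1 - alpha))); last first.
    by apply: ge0_ler_powR; rewrite ?nnegrE ?subr_ge0// powR_ge0.
  rewrite -powRrM -{1}(powRr1 (ltW c0)); apply: ger_powR => //.
  by rewrite mulrC -subr_sqr expr1n gerBl sqr_ge0.
apply: ler_wpDl => //.
rewrite powRD; last by rewrite (gt_eqF c0) implybT.
rewrite (powRr1 (ltW c0)); apply: ler_wpM2l; first exact: ltW.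
apply: ge0_ler_powR; rewrite ?nnegrE ?(ltW al0) ?(ltW c0)//; apply/ltW/(lt_le_trans cV).
rewrite -{2}(powRr1 (ltW c0)); apply: ger_powR => //.
by rewrite lerDl ltW.
Qed.

End powers.

Section one_step.
Context {R : realType} {n : nat}.
Variables (f : 'rV[R]_n -> R) (x0 : 'rV[R]_n) (beta s alpha A sigma C fl : R).
Hypothesis hbeta : 0 <= beta < 1.
Hypothesis df : forall x, differentiable f x.
Hypothesis f_ge : forall x, fl <= f x.
Hypothesis halpha : 0 < alpha <= 1.
Hypothesis hA : 0 < A.
Hypothesis f_hoelder : forall x y : 'rV[R]_n,
  norm2 (grad f x - grad f y) <= A * norm2 (x - y) `^ alpha.
Hypothesis hC : 0 < C.

Local Notation state := ('rV[R]_n * 'rV[R]_n)%type.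
Implicit Types (S : state) (X : 'rV[R]_n) (c : R).

(** [q] rescales the step of the averaged point, [kappa] the noise that enters the gap, and [p] is
    the ratio of the distance from iterate to averaged point to the length of the gap. *)
Let q := (1 - beta)^-1.
Let kappa := 1 - s * (1 - beta).
Let p := beta * q.

Let b1 : 0 < 1 - beta. Proof. by rewrite subr_gt0; case/andP: hbeta. Qed.
Let b0 : 0 <= beta. Proof. by case/andP: hbeta. Qed.
Let q0 : 0 < q. Proof. by rewrite invr_gt0. Qed.
Let qK : q * (1 - beta) = 1. Proof. by rewrite mulVf// gt_eqF. Qed.
Let al0 : 0 < alpha. Proof. by case/andP: halpha. Qed.
Let al1 : alpha <= 1. Proof. by case/andP: halpha. Qed.

(* Along the iteration the averaged point moves by plain stochastic gradient
   steps of size [gamma_t / (1 - beta)]. *)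
Definition sum_avg S : 'rV[R]_n := (1 - beta)^-1 *: (S.1 - beta *: S.2).

Definition sum_gap S : 'rV[R]_n := S.1 - S.2.

Lemma sum_avg_update c S X :
  sum_avg (sum_update beta s c S X) = sum_avg S - (q * c) *: X.
Proof.
apply/rowP => i; rewrite /sum_avg /sum_update /= !mxE -/q.
rewrite -[in RHS](mulr1 (q * c)) -[X in _ = _ - _ * X * _]qK.
have -> : q * c * (q * (1 - beta)) = q * c by rewrite qK mulr1.
by ring.
Qed.

Lemma sum_gap_update c S X :
  sum_gap (sum_update beta s c S X) = beta *: sum_gap S - (kappa * c) *: X.
Proof.
by apply/rowP => i; rewrite /sum_gap /sum_update /kappa /= !mxE; ring.
Qed.

Lemma sum_avgE S : S.1 = sum_avg S - p *: sum_gap S.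
Proof.
apply/rowP => i; rewrite /sum_avg /sum_gap /p !mxE -/q.
transitivity (q * (1 - beta) * S.1 0 i); first by rewrite qK mul1r.
by ring.
Qed.

Let N S := norm2 (grad f S.1) ^+ 2.
Let V S := norm2 (sum_gap S) ^+ 2.
(* [K] solves [q * A ^+ 2 * p ^+ 2 / 2 + beta * K = K]. *)
Let K := q ^+ 2 * A ^+ 2 * p ^+ 2 / 2.

Definition lyapunov S := f (sum_avg S) - fl + K * V S.

(** A quadratic majorant, up to constants, of both the Lyapunov function and the squared gradient.
    Its mean grows by at most a fixed factor per step whatever the stepsize, so it controls the
    times at which the drift is not yet available. *)
Definition moment S := 1 + norm2 (sum_avg S - x0) ^+ 2 + V S.

Let sqr_norm2_split X (m : 'rV[R]_n) :
  norm2 X ^+ 2 <= 2 * norm2 (X - m) ^+ 2 + 2 * norm2 m ^+ 2.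
Proof. by rewrite -{1}(subrK m X); exact: sqr_norm2D_le. Qed.

(** With [a = c^(1+alpha)], one step produces [a * (B / 2) * |X|^2], from the descent remainder and
    from the gap; the factor 2 pays for splitting [X] around its mean. [D] collects the terms in [a]
    free of the gradient: those from the Hoelder error, the descent remainder and the variance. *)
Let B := 2 * (A * q `^ (1 + alpha) + K * kappa ^+ 2 * q).
Let D := q * A ^+ 2 / 2 + A * q `^ (1 + alpha) + B * sigma ^+ 2.

Let K0 : 0 <= K.
Proof.
apply: divr_ge0 => //.
by do 2 (apply: mulr_ge0; last exact: sqr_ge0); exact: sqr_ge0.
Qed.

Let B0 : 0 <= B.
Proof.
rewrite mulr_ge0// addr_ge0// mulr_ge0 ?powR_ge0 ?(ltW hA) ?(ltW q0)//.
by rewrite mulr_ge0 ?sqr_ge0.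
Qed.

Lemma lyapunov_ge0 S : 0 <= lyapunov S.
Proof. by rewrite addr_ge0 ?subr_ge0// mulr_ge0 ?sqr_ge0. Qed.

Lemma moment_ge1 S : 1 <= moment S.
Proof. by rewrite /moment -addrA lerDl addr_ge0// sqr_ge0. Qed.

(** The right-hand side is arranged as constant, linear and quadratic parts in [X - m], ready for
    [ge0_integral_moments_le]. *)
Lemma lyapunov_update_le c S X : 0 <= c <= 1 ->
  let m := grad f S.1 in
  lyapunov (sum_update beta s c S X) <=
    (lyapunov S - q * c / 2 * N S +
     c `^ (1 + alpha) * (q * A ^+ 2 / 2 + A * q `^ (1 + alpha) + B * N S)) +
    dotv (- (q * c) *: grad f (sum_avg S)) (X - m) +
    B * c `^ (1 + alpha) * norm2 (X - m) ^+ 2.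
Proof.
move=> c01; have /andP[c0 c1] := c01; rewrite /lyapunov sum_avg_update /=.
set m := grad f S.1; set z := sum_avg S; set a := c `^ (1 + alpha).
have a0 : 0 <= a by exact: powR_ge0.
have XN := sqr_norm2_split X m.
have Xal : norm2 X `^ (1 + alpha) <= 1 + norm2 X ^+ 2.
  apply: powR_le1Dsqr; first exact: norm2_ge0.
  by rewrite addr_ge0 ?(ltW al0)// -[2]/(1 + 1) lerD2l.
have fz : f (z - (q * c) *: X) <= f z - q * c * dotv (grad f z) X
    + A * (q `^ (1 + alpha) * a * (1 + norm2 X ^+ 2)).
  have := holder_descent z (- ((q * c) *: X)) df al0 hA f_hoelder.
  rewrite -scaleNr dotvZr mulNr => /le_trans; apply; rewrite lerD2l.
  rewrite ler_wpM2l ?(ltW hA)// norm2Z normrN ger0_norm ?mulr_ge0 ?(ltW q0)//.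
  rewrite !powRM ?mulr_ge0 ?norm2_ge0 ?(ltW q0)//.
  by apply: ler_wpM2l Xal; rewrite mulr_ge0 ?powR_ge0.
have zm : norm2 (grad f z - m) ^+ 2 <= A ^+ 2 * (p ^+ 2 * V S) `^ alpha.
  have -> : p ^+ 2 * V S = norm2 (z - S.1) ^+ 2.
    rewrite [in RHS](sum_avgE S) opprB addrCA subrr addr0 norm2Z [RHS]exprMn.
    by rewrite real_normK// num_real.
  rewrite -sqr_powR ?norm2_ge0// -exprMn.
  by rewrite lerXn2r ?f_hoelder// nnegrE ?norm2_ge0// mulr_ge0 ?powR_ge0 ?(ltW hA).
have cV : c * (p ^+ 2 * V S) `^ alpha <= p ^+ 2 * V S + a.
  by apply: weighted_powR_le => //; rewrite mulr_ge0 ?sqr_ge0.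
(* Polarization: [-2 <u, m> = |u - m|^2 - |u|^2 - |m|^2] with [u = grad f z]. The term [-|u|^2] is
   dropped, and [|u - m|^2] is bounded by [zm] and [cV]. *)
have inner : - (q * c) * dotv (grad f z) m <=
    - (q * c) / 2 * N S + q / 2 * A ^+ 2 * (p ^+ 2 * V S + a).
  have e1 := sqr_norm2B_dotv (grad f z) m.
  have e2 : 0 <= norm2 (grad f z) ^+ 2 by exact: sqr_ge0.
  have e3 : - dotv (grad f z) m <=
      - (1 / 2) * N S + 1 / 2 * (A ^+ 2 * (p ^+ 2 * V S) `^ alpha).
    by rewrite /N -/m; lra.
  have qc0 : 0 <= q * c by rewrite mulr_ge0 ?(ltW q0).
  have := ler_wpM2l qc0 e3.
  have : 0 <= q / 2 * A ^+ 2 by rewrite mulr_ge0 ?sqr_ge0// divr_ge0 ?(ltW q0).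
  move=> /ler_wpM2l /(_ _ _ cV) h1 h2.
  rewrite mulNr -mulrN; apply: le_trans h2 _.
  rewrite [X in X <= _](_ : _ = - (q * c) / 2 * N S +
     q / 2 * A ^+ 2 * (c * (p ^+ 2 * V S) `^ alpha)); last by field.
  by rewrite lerD2l.
have gap : V (sum_update beta s c S X) <=
    beta * V S + kappa ^+ 2 * q * a * norm2 X ^+ 2.
  rewrite {1}/V sum_gap_update.
  apply: le_trans (sqr_norm2_contraction (kappa * c) _ _ hbeta) _.
  rewrite lerD2l -/q ler_wpM2r ?sqr_ge0// exprMn mulrAC ler_wpM2l//.
    by rewrite mulr_ge0 ?sqr_ge0 ?(ltW q0).
  (* The contraction yields [c^2], which is at most [c^(1+alpha)] since [c <= 1] and
     [1 + alpha <= 2]; comparing the powers requires a positive base. *)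
  have [->|c0'] := eqVneq c 0; first by rewrite expr0n/= powR_ge0.
  rewrite -powR_mulrn//; apply: ger_powR; last by rewrite -[2%:R]/(1 + 1) lerD2l.
  by rewrite lt_def c0' c0 c1.
have KE : q / 2 * A ^+ 2 * p ^+ 2 + K * beta = K.
  rewrite -[RHS]mulr1 -[X in _ = _ * X](subrK beta 1) mulrDr; congr (_ + _).
  rewrite /K -[LHS]mulr1 -[X in _ * X = _]qK.
  by field.
have Kgap := ler_wpM2l K0 gap.
have BX : a * (B / 2) * norm2 X ^+ 2 <=
    a * (B / 2) * (2 * norm2 (X - m) ^+ 2 + 2 * N S).
  by apply: ler_wpM2l => //; rewrite mulr_ge0// divr_ge0.
have dXm : dotv (grad f z) X = dotv (grad f z) (X - m) + dotv (grad f z) m.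
  by rewrite dotvBr subrK.
rewrite dotvZl.
move: fz; rewrite dXm; set d1 := dotv _ (X - m).
move: inner; set d2 := dotv _ m.
move: Kgap BX KE; rewrite /B.
set Q := norm2 (X - m) ^+ 2; set XX := norm2 X ^+ 2.
set VV := V _; set NN := N _; set qq := q `^ (1 + alpha); set fz' := f (z - _).
move: VV NN qq fz' Q XX d1 d2 (V S) (f z) => VV NN qq fz' Q XX d1 d2 vS fz.
move=> Kgap BX KE inner fz1.
(* First the descent inequality and the contraction of the gap are inserted, then the bounds [inner]
   and [BX]. *)
apply: (@le_trans _ _ ((fz - q * c * (d1 + d2) + A * (qq * a * (1 + XX))) - fl +
  K * (beta * vS + kappa ^+ 2 * q * a * XX))); first by lra.
have -> : fz - q * c * (d1 + d2) + A * (qq * a * (1 + XX)) - fl +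
    K * (beta * vS + kappa ^+ 2 * q * a * XX) =
    (fz - fl - q * c * d1) + (- (q * c) * d2) + A * qq * a + K * beta * vS +
    a * (2 * (A * qq + K * kappa ^+ 2 * q) / 2) * XX by field.
apply: (@le_trans _ _ ((fz - fl - q * c * d1) +
   (- (q * c) / 2 * NN + q / 2 * A ^+ 2 * (p ^+ 2 * vS + a)) + A * qq * a +
   K * beta * vS + a * (2 * (A * qq + K * kappa ^+ 2 * q) / 2) *
   (2 * Q + 2 * NN))); first by lra.
(* Expanding [K] by its fixed-point equation makes the [vS] terms cancel and leaves an identity. *)
rewrite -[X in _ <= fz - fl + X * vS - _ + _ + _ + _]KE.
by rewrite le_eqVlt; apply/orP; left; apply/eqP; field.
Qed.

(** By the Hoelder condition the gradient grows at most like [|x - x0|^alpha], with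
    [2 * alpha <= 2], and [x - x0] is [(z - x0) - p v]. *)
Lemma sqr_norm2_grad_le S : N S <=
  (2 * A ^+ 2 * (2 + 2 * p ^+ 2) + 2 * norm2 (grad f x0) ^+ 2) * moment S.
Proof.
set n0 := norm2 (grad f x0) ^+ 2; set Z := norm2 (sum_avg S - x0) ^+ 2.
have hx : norm2 (S.1 - x0) ^+ 2 <= 2 * Z + 2 * (p ^+ 2 * V S).
  rewrite {1}(sum_avgE S) addrAC; apply: le_trans (sqr_norm2B_le _ _) _.
  by rewrite norm2Z [(`|_| * _) ^+ 2]exprMn real_normK// num_real.
have hg : norm2 (grad f S.1 - grad f x0) ^+ 2 <=
    A ^+ 2 * (1 + norm2 (S.1 - x0) ^+ 2).
  apply: (@le_trans _ _ ((A * norm2 (S.1 - x0) `^ alpha) ^+ 2)).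
    by rewrite lerXn2r ?f_hoelder// nnegrE ?norm2_ge0// mulr_ge0 ?powR_ge0 ?(ltW hA).
  rewrite exprMn; apply: ler_wpM2l; first exact: sqr_ge0.
  rewrite -(powR_mulrn 2 (powR_ge0 _ _)) -powRrM; apply: powR_le1Dsqr.
    exact: norm2_ge0.
  by rewrite mulr_ge0 ?(ltW al0)//= -{2}[2]mul1r ler_wpM2r.
have hN : N S <= 2 * norm2 (grad f S.1 - grad f x0) ^+ 2 + 2 * n0.
  by rewrite /N -{1}(subrK (grad f x0) (grad f S.1)); exact: sqr_norm2D_le.
rewrite /moment -/Z.
have Z0 : 0 <= Z by exact: sqr_ge0.
have V0 : 0 <= V S by exact: sqr_ge0.
have n00 : 0 <= n0 by exact: sqr_ge0.
have p20 : 0 <= p ^+ 2 by exact: sqr_ge0.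
have A20 : 0 <= A ^+ 2 by exact: sqr_ge0.
have h1 := ler_wpM2l A20 hx.
apply: (@le_trans _ _ (2 * (A ^+ 2 * (1 + (2 * Z + 2 * (p ^+ 2 * V S)))) + 2 * n0)).
  by lra.
have := (mulr_ge0 A20 p20, mulr_ge0 A20 V0, mulr_ge0 (mulr_ge0 A20 p20) Z0,
  mulr_ge0 n00 Z0, mulr_ge0 n00 V0).
by move=> [[[[h2 h3] h4] h5] h6]; lra.
Qed.

(** The descent inequality started at [x0] bounds [f] at the averaged point; Young's inequality
    handles the inner product. *)
Lemma lyapunov_le_moment S : lyapunov S <=
  (f x0 - fl + norm2 (grad f x0) ^+ 2 + 1 + 2 * A + K) * moment S.
Proof.
set n0 := norm2 (grad f x0) ^+ 2; set h := sum_avg S - x0.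
have := holder_descent x0 h df al0 hA f_hoelder; rewrite /h subrKC -/h => fz.
have hpow : norm2 h `^ (1 + alpha) <= 1 + norm2 h ^+ 2.
  apply: powR_le1Dsqr; first exact: norm2_ge0.
  by rewrite addr_ge0 ?(ltW al0)// -[2]/(1 + 1) lerD2l.
have hd : 2 * dotv (grad f x0) h <= n0 + norm2 h ^+ 2.
  have := sqr_ge0 (norm2 (grad f x0 - h)); rewrite sqr_norm2B_dotv -/n0; lra.
have h1 := ler_wpM2l (ltW hA) hpow.
rewrite /moment /lyapunov -/h.
have Z0 : 0 <= norm2 h ^+ 2 by exact: sqr_ge0.
have V0 : 0 <= V S by exact: sqr_ge0.
have n00 : 0 <= n0 by exact: sqr_ge0.
have f0 : 0 <= f x0 - fl by rewrite subr_ge0.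
have A0 := ltW hA.
move: fz h1 hd Z0 V0 K0; set dd := dotv _ _; move: (norm2 h ^+ 2) (V S) => Z VS.
move: (norm2 h `^ _) dd (f (sum_avg S)) => pw dd fz fz1 h1 hd Z0 V0 KK0.
apply: (@le_trans _ _ (f x0 - fl + (n0 + Z) / 2 + A * (1 + Z) + K * VS)); first by lra.
have := (mulr_ge0 f0 Z0, mulr_ge0 f0 V0, mulr_ge0 n00 Z0, mulr_ge0 n00 V0,
  mulr_ge0 A0 Z0, mulr_ge0 A0 V0, mulr_ge0 KK0 Z0).
by move=> [[[[[[h2 h3] h4] h5] h6] h7] h8]; lra.
Qed.

(** Unbiasedness and the variance bound at a single frozen point, the form in which they serve once
    the past is fixed. *)
Definition oracle_sample (dO : measure_display) (Omega : measurableType dO)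
    (P : probability Omega R) (X : Omega -> 'rV[R]_n) (x : 'rV[R]_n) :=
  [/\ forall i, P.-integrable setT (fun w => (X w 0 i)%:E),
      forall i, (\int[P]_w (X w 0 i)%:E = (grad f x 0 i)%:E)%E &
      (\int[P]_w (norm2 (X w - grad f x) ^+ 2)%:E <=
        (sigma ^+ 2 + C * norm2 (grad f x) ^+ 2)%:E)%E].

Section expectation.
Context {dO : measure_display} {Omega : measurableType dO}.
Variables (P : probability Omega R) (X : Omega -> 'rV[R]_n) (S : state).
Hypothesis hX : oracle_sample P X S.1.

(** The mean of the quadratic part adds [B * C * a * N S] to the existing [B * a * N S]. The
    smallness condition lets the two consume half of the decrease [q * c / 2 * N S]. *)
Lemma integral_lyapunov_update_le c : 0 <= c <= 1 ->
  B * (1 + C) * c `^ (1 + alpha) <= q * c / 4 ->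
  measurable_fun setT (fun w => lyapunov (sum_update beta s c S (X w))) ->
  (\int[P]_w (lyapunov (sum_update beta s c S (X w)))%:E <=
   (lyapunov S - q * c / 4 * N S + D * c `^ (1 + alpha))%:E)%E.
Proof.
move=> c01 Bc mL; have [iX EX VX] := hX.
have B'0 : 0 <= B * c `^ (1 + alpha) by rewrite mulr_ge0 ?powR_ge0.
apply: le_trans (ge0_integral_moments_le iX EX VX mL
  (fun u => lyapunov_ge0 _) B'0 (fun u => lyapunov_update_le _ _ c01)) _.
rewrite lee_fin -/(N S).
have N0 : 0 <= N S by exact: sqr_ge0.
have := ler_wpM2r N0 Bc; rewrite /D; move: (N S) (c `^ _) (q `^ _) => NS a qq.
by lra.
Qed.

(** The coefficient of [|X|^2] in one step of [moment]. *)
Let E2 c := 2 * (q * c) ^+ 2 + (kappa * c) ^+ 2 / (1 - beta).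
Let H := 2 * A ^+ 2 * (2 + 2 * p ^+ 2) + 2 * norm2 (grad f x0) ^+ 2.

Lemma integral_moment_update_le c :
  measurable_fun setT (fun w => moment (sum_update beta s c S (X w))) ->
  (\int[P]_w (moment (sum_update beta s c S (X w)))%:E <=
   ((2 + 2 * E2 c * (sigma ^+ 2 + (1 + C) * H)) * moment S)%:E)%E.
Proof.
move=> mM; have [iX EX VX] := hX.
have E20 : 0 <= E2 c.
  apply: addr_ge0; first by apply: mulr_ge0 => //; exact: sqr_ge0.
  by apply: divr_ge0; [exact: sqr_ge0|exact: ltW].
have M1 := moment_ge1 S.
have NH := sqr_norm2_grad_le S.
set m := grad f S.1; set z := norm2 (sum_avg S - x0) ^+ 2.
apply: (@le_trans _ _ ((1 + 2 * z + V S + 2 * E2 c * N S) +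
    2 * E2 c * (sigma ^+ 2 + C * N S))%:E).
  (* The linear coefficient is taken to be 0: [|X|^2] is split crudely around [m], with no cross
     term. *)
  apply: (@ge0_integral_moments_le _ _ _ _ _ _ _ 0 _ _ _
    (fun Y => moment (sum_update beta s c S Y)) iX EX VX mM) => [u||u].
  - exact: le_trans (moment_ge1 _).
  - by rewrite mulr_ge0.
  have XN := ler_wpM2l E20 (sqr_norm2_split u m).
  have h1 : norm2 (sum_avg (sum_update beta s c S u) - x0) ^+ 2 <=
      2 * z + 2 * (q * c) ^+ 2 * norm2 u ^+ 2.
    rewrite sum_avg_update addrAC; apply: le_trans (sqr_norm2B_le _ _) _.
    by rewrite norm2Z [(`|_| * _) ^+ 2]exprMn real_normK ?num_real// /z; lra.
  have h2 : V (sum_update beta s c S u) <=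
      V S + (kappa * c) ^+ 2 / (1 - beta) * norm2 u ^+ 2.
    rewrite {1}/V sum_gap_update.
    apply: le_trans (sqr_norm2_contraction (kappa * c) _ _ hbeta) _.
    rewrite lerD2r -[leRHS]mul1r ler_wpM2r ?sqr_ge0//.
    by rewrite -subr_ge0 ltW.
  have -> : dotv 0 (u - grad f S.1) = 0.
    by apply: big1 => i _; rewrite mxE mul0r.
  rewrite /moment addr0 -/(N S) -/m.
  apply: (@le_trans _ _ (1 + 2 * z + V S + E2 c * norm2 u ^+ 2)).
    by rewrite /E2; lra.
  by move: XN; rewrite /N -/m; lra.
rewrite lee_fin.
have V0 : 0 <= V S by exact: sqr_ge0.
have C1 : 0 <= 1 + C by rewrite addr_ge0 ?(ltW hC).
have s0 : 0 <= sigma ^+ 2 by exact: sqr_ge0.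
have h3 := ler_wpM2l E20 (ler_wpM2l C1 NH).
have h4 := ler_wpM2l E20 (ler_wpM2l s0 M1).
rewrite -/H in h3.
have h5 : 1 + 2 * z + V S <= 2 * moment S by rewrite /moment -/z; lra.
move: h3 h4 h5; move: (E2 c) (moment S) (N S) => e M NS; lra.
Qed.

End expectation.

(** The constants are quantified before the probability space, so that the final bound depends on
    the data alone; the next two lemmas have this form for the same reason. *)
Lemma lyapunov_drift : exists B' D' : R, [/\ 0 <= B', 0 <= D' &
  forall (dO : measure_display) (Omega : measurableType dO)
    (P : probability Omega R) (X : Omega -> 'rV[R]_n) S c,
    oracle_sample P X S.1 -> 0 <= c <= 1 -> B' * c `^ (1 + alpha) <= q * c / 4 ->
    measurable_fun setT (fun w => lyapunov (sum_update beta s c S (X w))) ->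
    (\int[P]_w (lyapunov (sum_update beta s c S (X w)))%:E <=
     (lyapunov S - q * c / 4 * N S + D' * c `^ (1 + alpha))%:E)%E].
Proof.
exists (B * (1 + C)), D; split.
- by apply: mulr_ge0 => //; apply: addr_ge0 => //; exact: ltW.
- apply: addr_ge0; last by apply: mulr_ge0 => //; exact: sqr_ge0.
  apply: addr_ge0; last by apply: mulr_ge0; [exact: ltW|exact: powR_ge0].
  apply: divr_ge0 => //; apply: mulr_ge0; [exact: ltW|exact: sqr_ge0].
- by move=> *; exact: integral_lyapunov_update_le.
Qed.

Lemma moment_growth c : exists E : R,
  forall (dO : measure_display) (Omega : measurableType dO)
    (P : probability Omega R) (X : Omega -> 'rV[R]_n) S,
    oracle_sample P X S.1 ->
    measurable_fun setT (fun w => moment (sum_update beta s c S (X w))) ->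
    (\int[P]_w (moment (sum_update beta s c S (X w)))%:E <= (E * moment S)%:E)%E.
Proof. by eexists => *; exact: integral_moment_update_le. Qed.

Lemma le_moment : exists H : R, [/\ 0 <= H,
  forall S, norm2 (grad f S.1) ^+ 2 <= H * moment S &
  forall S, lyapunov S <= H * moment S].
Proof.
pose h1 := 2 * A ^+ 2 * (2 + 2 * p ^+ 2) + 2 * norm2 (grad f x0) ^+ 2.
pose h2 := f x0 - fl + norm2 (grad f x0) ^+ 2 + 1 + 2 * A + K.
exists (Num.max 0 (Num.max h1 h2)); split; first by rewrite le_max lexx.
- move=> S; apply: le_trans (sqr_norm2_grad_le S) _; apply: ler_wpM2r.
    exact: le_trans (moment_ge1 S).
  by rewrite !le_max lexx orbT.
- move=> S; apply: le_trans (lyapunov_le_moment S) _; apply: ler_wpM2r.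
    exact: le_trans (moment_ge1 S).
  by rewrite !le_max lexx !orbT.
Qed.

End one_step.

(** * Expectations along the process *)

Section measurability.
Context {R : realType} {n : nat}.
Local Notation state := (borel_rV R n * borel_rV R n)%type.

Lemma measurable_sqr_norm2 d (T : measurableType d) (F : T -> 'rV[R]_n) :
  (forall i, measurable_fun setT (fun x => F x 0 i)) ->
  measurable_fun setT (fun x => norm2 (F x) ^+ 2).
Proof.
move=> mF; under eq_fun do rewrite sqr_norm2.
by apply: measurable_sum => i; exact: measurable_funX.
Qed.

Lemma measurable_fst_coord i :
  measurable_fun [set: state] (fun S : state => (S.1 : 'rV[R]_n) 0 i).
Proof. exact: (measurableT_comp (measurable_coord i) measurable_fst). Qed.

Lemma measurable_snd_coord i :
  measurable_fun [set: state] (fun S : state => (S.2 : 'rV[R]_n) 0 i).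
Proof. exact: (measurableT_comp (measurable_coord i) measurable_snd). Qed.

Lemma measurable_sum_avg beta :
  measurable_fun [set: state] (sum_avg beta : state -> borel_rV R n).
Proof.
apply: measurable_fun_rV => i; under eq_fun do rewrite !mxE.
apply: measurable_funM => //; apply: measurable_funB.
  exact: measurable_fst_coord.
by apply: measurable_funM => //; exact: measurable_snd_coord.
Qed.

Lemma measurable_sqr_norm2_gap :
  measurable_fun [set: state] (fun S : state => norm2 (sum_gap S) ^+ 2).
Proof.
apply: measurable_sqr_norm2 => i; under eq_fun do rewrite !mxE.
by apply: measurable_funB; [exact: measurable_fst_coord|exact: measurable_snd_coord].
Qed.

Lemma measurable_lyapunov (f : 'rV[R]_n -> R) beta A fl :
  (forall x, differentiable f x) ->
  measurable_fun [set: state] (lyapunov f beta A fl : state -> R).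
Proof.
move=> df; apply: measurable_funD; last first.
  by apply: measurable_funM => //; exact: measurable_sqr_norm2_gap.
apply: measurable_funB => //.
apply: (measurableT_comp _ (measurable_sum_avg beta)).
by apply: continuous_measurable_rV => x; exact: differentiable_continuous.
Qed.

Lemma measurable_moment (x0 : 'rV[R]_n) beta :
  measurable_fun [set: state] (moment x0 beta : state -> R).
Proof.
apply: measurable_funD; last exact: measurable_sqr_norm2_gap.
apply: measurable_funD => //; apply: measurable_sqr_norm2 => i.
under eq_fun do rewrite !mxE; apply: measurable_funB => //.
have := measurableT_comp (measurable_coord i) (measurable_sum_avg beta).
by apply: eq_measurable_fun => S _ /=; rewrite !mxE.
Qed.

Lemma measurable_sqr_norm2_grad (f : 'rV[R]_n -> R) : continuous (grad f) ->
  measurable_fun [set: state] (fun S : state => norm2 (grad f S.1) ^+ 2).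
Proof.
move=> cf; apply: measurable_sqr_norm2 => i.
apply: (measurableT_comp (f := fun x : borel_rV R n => grad f x 0 i)
  _ measurable_fst).
apply: continuous_measurable_rV => x.
apply: (@continuous_comp _ _ _ (grad f) (fun v : 'rV[R]_n => v 0 i)).
  exact: cf.
exact: coord_continuous.
Qed.

End measurability.

Section process.
Context {R : realType} {n : nat} {dO dX : measure_display}.
Context {Omega : measurableType dO} {P : probability Omega R}.
Context {Xi : measurableType dX} {xi : nat -> {RV P >-> Xi}}.
Context {g : 'rV[R]_n -> Xi -> 'rV[R]_n}.
Variables (beta s : R) (gamma : nat -> R) (x0 : 'rV[R]_n).
Hypothesis mg : borel_oracle g.
Hypothesis indep : mutually_independent xi.

Local Notation state := (borel_rV R n * borel_rV R n)%type.
Let St (t : nat) (w : Omega) : state :=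
  sum_state g beta s gamma x0 (fun k => xi k w) t.

Lemma measurable_sum_process t : measurable_fun setT (St t).
Proof.
apply: (@measurable_sum_state R n dO Omega dX Xi g beta s gamma x0
  (fun k => xi k)) => // k _; exact: measurable_funP.
Qed.

(** The state at time [t] is measurable for the sigma-algebra of the past cylinders, from which
    [xi t] is independent. *)
Lemma sum_process_indep t A B : measurable A -> measurable B ->
  (P (St t @^-1` A `&` xi t @^-1` B) = P (St t @^-1` A) * P (xi t @^-1` B))%E.
Proof.
move=> mA mB; apply: past_indep => //.
rewrite -[_ @^-1` A]setTI.
exact: (@measurable_sum_state R n _ (g_sigma_algebraType (past_cylinders xi t))
  dX Xi g beta s gamma x0 (fun k => xi k) t mg (@measurable_past _ _ _ _ _ _ xi t)).
Qed.

(** This stands in for conditional expectation: an estimate valid for every frozen state, averaged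
    over the fresh input alone, passes to the process. *)
Lemma integral_sum_process_step (phi psi : state -> R) t :
  measurable_fun setT phi -> (forall S, 0 <= phi S) -> measurable_fun setT psi ->
  (forall S : state, \int[P]_w (phi (sum_update beta s (gamma t) S (g S.1 (xi t w))))%:E
     <= (psi S)%:E)%E ->
  (\int[P]_w (phi (St t.+1 w))%:E <= \int[P]_w (psi (St t w))%:E)%E.
Proof.
move=> mphi phi0 mpsi le_psi.
pose h (z : state * Xi) : \bar R :=
  (phi (sum_update beta s (gamma t) z.1 (g z.1.1 z.2)))%:E.
have mh : measurable_fun setT h.
  apply/measurable_EFinP; apply: (measurableT_comp mphi).
  apply: (measurableT_comp (measurable_sum_update beta s (gamma t))
    (g := fun z : state * Xi => (z.1, g z.1.1 z.2 : borel_rV R n))).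
  apply: measurable_fun_pair; first exact: measurable_fst.
  apply: (measurableT_comp mg (g := fun z : state * Xi => (z.1.1, z.2))).
  apply: measurable_fun_pair; last exact: measurable_snd.
  exact: (measurableT_comp measurable_fst measurable_fst).
have h0 z : (0 <= h z)%E by rewrite lee_fin.
pose X : {mfun Omega >-> state} :=
  HB.pack (St t) (isMeasurableFun.Build _ _ _ _ _ (measurable_sum_process t)).
rewrite (_ : (\int[P]_w _)%E = \int[P]_w h (X w, xi t w))%E; last first.
  by apply: eq_integral => w _; rewrite /h /= /St sum_stateS.
rewrite (@ge0_integral_indep_pair _ _ _ _ _ P _ _ X (xi t)) //; last first.
  exact: sum_process_indep.
have mSt := measurable_sum_process t.
apply: ge0_le_integral => //.
- by move=> w _; exact: integral_ge0.
(* The inner integral is a Tonelli section against the law of [xi t], evaluated at the current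
   state. *)
- have := measurable_fun_fubini_tonelli_F (m2 := distribution P (xi t)) h mh h0.
  move=> /measurableT_comp /(_ mSt); apply: eq_measurable_fun => w _ /=.
  by rewrite /fubini_F ge0_integral_distribution//; exact: measurableT_comp.
- by apply/measurable_EFinP; exact: measurableT_comp.
- by move=> w _; exact: le_psi.
Qed.

End process.

(** * Telescoping and small stepsizes *)

Lemma telescope_drift (R : realType) (L u v : nat -> \bar R) (T : nat) :
  (forall t, (T <= t)%N -> L t.+1 + u t <= L t + v t)%E ->
  forall n, (L (T + n)%N + \sum_(T <= t < T + n) u t <=
             L T + \sum_(T <= t < T + n) v t)%E.
Proof.
move=> drift; elim=> [|n ih]; first by rewrite addn0 !big_geq.
rewrite addnS !big_nat_recr ?leq_addr//= !addeA.
rewrite addeAC; apply: le_trans (leeD2r _ (drift _ (leq_addr _ _))) _.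
by rewrite [leLHS]addeAC; exact: leeD2r _ ih.
Qed.

(** Terms of a convergent series tend to 0, hence so do the stepsizes; then [gamma t^(1+alpha) =
    gamma t * gamma t^alpha] and the second factor falls below [c]. *)
Lemma eventually_small_step (R : realType) (gamma : nat -> R) (alpha c : R) :
  (forall t, 0 <= gamma t) -> 0 < alpha -> 0 < c ->
  (\sum_(0 <= t <oo) (gamma t `^ (1 + alpha))%:E < +oo)%E ->
  exists T, forall t, (T <= t)%N ->
    gamma t <= 1 /\ gamma t `^ (1 + alpha) <= c * gamma t.
Proof.
move=> g0 al0 c0 gsum; set a := fun t => gamma t `^ (1 + alpha).
have a0 t : 0 <= a t by exact: powR_ge0.
have ae0 t : (0 <= t)%N -> true -> (0 <= (a t)%:E)%E by rewrite lee_fin.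
have al1 : 0 < 1 + alpha by exact: addr_gt0.
have fin : (\sum_(0 <= t <oo) (a t)%:E)%E \is a fin_num.
  by rewrite ge0_fin_numE// nneseries_ge0// => t _ _; rewrite lee_fin.
have /cvg_series_cvg_0 a_cvg : cvgn (series a).
  apply: nondecreasing_is_cvgn.
    by apply: nondecreasing_series => t _ _; exact: a0.
  exists (fine (\sum_(0 <= t <oo) (a t)%:E)%E) => _ [k _ <-].
  by rewrite -lee_fin fineK// -sumEFin; exact: nneseries_lim_ge.
(* Below [1] for the first claim; below [c^(1/alpha)] so that the [alpha]-th power is at most
   [c]. *)
pose r := Num.min 1 (c `^ alpha^-1).
have r0 : 0 < r by rewrite lt_min ltr01 powR_gt0.
have [T _ TP] := cvgr0_norm_lt _ a_cvg (r `^ (1 + alpha)) (powR_gt0 _ r0).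
exists T => t /TP /=; rewrite ger0_norm// /a => agt.
have gr : gamma t <= r.
  rewrite leNgt; apply/negP => rg.
  have := lt_trans agt (gt0_ltr_powR al1 (ltW r0) (g0 t) rg).
  by rewrite ltxx.
move: (gr); rewrite /r le_min => /andP[g1 gc]; split => //.
have [->|gn0] := eqVneq (gamma t) 0.
  by rewrite mulr0 powR0// gt_eqF.
rewrite powRD; last by rewrite gn0 implybT.
rewrite powRr1// mulrC ler_wpM2r//.
apply: (@le_trans _ _ ((c `^ alpha^-1) `^ alpha)).
  by apply: ge0_ler_powR; rewrite ?nnegrE ?powR_ge0// ltW.
by rewrite -powRrM mulVf ?gt_eqF// powRr1// ltW.
Qed.

(** * Expectations of the moment and of the Lyapunov function *)

Section process_bounds.
Context {R : realType} {n : nat} {dO dX : measure_display}.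
Context {Omega : measurableType dO} {P : probability Omega R}.
Context {Xi : measurableType dX} {xi : nat -> {RV P >-> Xi}}.
Context {g : 'rV[R]_n -> Xi -> 'rV[R]_n}.
Variables (f : 'rV[R]_n -> R) (beta s sigma C : R) (gamma : nat -> R).
Variable x0 : 'rV[R]_n.
Hypothesis df : forall x, differentiable f x.
Hypothesis cgrad : continuous (grad f).
Hypothesis mg : borel_oracle g.
Hypothesis indep : mutually_independent xi.
Hypothesis sample : forall t x, oracle_sample f sigma C P (fun w => g x (xi t w)) x.

Local Notation state := (borel_rV R n * borel_rV R n)%type.
Local Notation St t w := (sum_state g beta s gamma x0 (fun k => xi k w) t).
Local Notation sqgrad S := (norm2 (grad f S.1) ^+ 2).

Lemma measurable_comp_sum_process (phi : state -> R) t :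
  measurable_fun setT phi ->
  measurable_fun setT (fun w => (phi (St t w))%:E).
Proof.
move=> mphi; apply/measurable_EFinP.
exact: (measurableT_comp mphi (measurable_sum_process beta s gamma x0 mg t)).
Qed.

Lemma measurable_oracle_update (phi : state -> R) t (S : state) :
  measurable_fun setT phi ->
  measurable_fun setT
    (fun w => phi (sum_update beta s (gamma t) S (g S.1 (xi t w)))).
Proof.
move=> mphi; apply: (measurableT_comp mphi).
apply: (measurableT_comp (measurable_sum_update beta s (gamma t))
  (g := fun w => (S, g S.1 (xi t w) : borel_rV R n))).
apply: measurable_fun_pair => //.
apply: (measurableT_comp mg (g := fun w => (S.1, xi t w))).
by apply: measurable_fun_pair => //; exact: measurable_funP.
Qed.

(** Induction on [t]. Truncating each factor at 0 supplies the sign needed to multiply the inductive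
    bound, since the growth estimate does not state one for [E]. *)
Lemma moment_process_le (E : R -> R) t :
  (forall c (X : Omega -> 'rV[R]_n) (S : state),
    oracle_sample f sigma C P X S.1 ->
    measurable_fun setT (fun w => moment x0 beta (sum_update beta s c S (X w))) ->
    (\int[P]_w (moment x0 beta (sum_update beta s c S (X w)))%:E <=
       (E c * moment x0 beta S)%:E)%E) ->
  (\int[P]_w (moment x0 beta (St t w))%:E <=
    (moment x0 beta (x0, x0) * \prod_(k < t) Num.max 0 (E (gamma k)))%:E)%E.
Proof.
move=> hE; have mM := measurable_moment x0 beta.
have M0 (S : state) : 0 <= moment x0 beta S by exact: le_trans (moment_ge1 _ _ S).
elim: t => [|t ih].
  by rewrite big_ord0 mulr1 /= integral_probability_cst.
pose e := Num.max 0 (E (gamma t)).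
have e0 : 0 <= e by rewrite le_max lexx.
apply: le_trans (integral_sum_process_step (t := t) (beta := beta) (s := s)
  (gamma := gamma) x0 mg indep (psi := fun S => e * moment x0 beta S) mM M0 _ _) _.
- exact: measurable_funM.
- move=> S; apply: le_trans (hE _ _ _ (sample t S.1) _) _.
    exact: measurable_oracle_update.
  by rewrite lee_fin ler_wpM2r// le_max lexx orbT.
under eq_integral do rewrite EFinM.
rewrite ge0_integralZl_EFin//; last 2 first.
- by move=> w _; rewrite lee_fin.
- exact: measurable_comp_sum_process.
rewrite big_ord_recr /= -/e mulrA mulrC EFinM.
by apply: lee_wpmul2l => //; rewrite lee_fin.
Qed.

Lemma lyapunov_process_drift (A fl eta v : R) t :
  (forall x, fl <= f x) -> 0 <= eta -> 0 <= v ->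
  (forall S : state,
    \int[P]_w (lyapunov f beta A fl
      (sum_update beta s (gamma t) S (g S.1 (xi t w))))%:E <=
    (lyapunov f beta A fl S - eta * sqgrad S + v)%:E)%E ->
  (\int[P]_w (lyapunov f beta A fl (St t.+1 w))%:E +
     eta%:E * \int[P]_w (sqgrad (St t w))%:E <=
   \int[P]_w (lyapunov f beta A fl (St t w))%:E + v%:E)%E.
Proof.
move=> f_ge eta0 v0 drift.
have mL := measurable_lyapunov beta A fl df.
have mN := measurable_sqr_norm2_grad cgrad.
have L0 (S : state) : 0 <= lyapunov f beta A fl S by exact: lyapunov_ge0.
pose psi (S : state) := lyapunov f beta A fl S - eta * sqgrad S + v.
have mpsi : measurable_fun setT psi.
  apply: measurable_funD => //; apply: measurable_funB => //.
  exact: measurable_funM.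
(* [psi] dominates the integral of a nonnegative function. *)
have psi0 (S : state) : 0 <= psi S.
  rewrite -lee_fin; apply: le_trans (drift S).
  by apply: integral_ge0 => w _; rewrite lee_fin.
have mEN : measurable_fun setT (fun w => (sqgrad (St t w))%:E).
  exact: (measurable_comp_sum_process (phi := fun S : state => sqgrad S)).
have N0 w : (0 <= (sqgrad (St t w))%:E)%E by rewrite lee_fin sqr_ge0.
apply: (@le_trans _ _ (\int[P]_w (psi (St t w))%:E +
    eta%:E * \int[P]_w (sqgrad (St t w))%:E)%E).
  apply: leeD2r.
  exact: (integral_sum_process_step x0 mg indep (psi := psi) mL L0 mpsi drift).
rewrite -ge0_integralZl_EFin// -ge0_integralD//; last 4 first.
- by move=> w _; rewrite lee_fin.
- exact: measurable_comp_sum_process.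
- by move=> w _; apply: mule_ge0; [rewrite lee_fin|exact: N0].
- exact: measurable_funeM.
(* Adding the gradient term back under the integral cancels the one subtracted in [psi], so no
   extended reals are ever subtracted. *)
rewrite [leLHS](_ : _ =
    (\int[P]_w ((lyapunov f beta A fl (St t w))%:E + v%:E)))%E; last first.
  by apply: eq_integral => w _; rewrite -EFinM -!EFinD /psi addrAC subrK.
rewrite ge0_integralD//; last 2 first.
- by move=> w _; rewrite lee_fin.
- exact: measurable_comp_sum_process.
by rewrite integral_probability_cst.
Qed.

End process_bounds.

(** * The constant and the final summation *)

Theorem theorem1 (R : realType) (d : nat) (f : 'rV[R]_d -> R)
    (x0 : 'rV[R]_d) (beta s : R) (gamma : nat -> R) (alpha A sigma C : R)
    (hbeta : 0 <= beta < 1) (hs : 0 <= s)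
    (hf_C1 : continuously_differentiable f)
    (hf_inf : (-oo < ereal_inf (range (fun x => (f x)%:E)))%E)
    (halpha : 0 < alpha <= 1) (hA : 0 < A)
    (hf_hoelder : forall x y : 'rV[R]_d,
       norm2 (grad f x - grad f y) <= A * norm2 (x - y) `^ alpha)
    (hsigma : 0 < sigma) (hC : 0 < C)
    (hgamma_ge0 : forall t, 0 <= gamma t)
    (hgamma_div : (\sum_(0 <= t <oo) (gamma t)%:E = +oo)%E)
    (hgamma_sum : (\sum_(0 <= t <oo) (gamma t `^ (1 + alpha))%:E < +oo)%E) :
  exists C0 : R,
  forall (dO dX : measure_display) (Omega : measurableType dO)
    (P : probability Omega R) (Xi : measurableType dX)
    (xi : nat -> {RV P >-> Xi}) (g : 'rV[R]_d -> Xi -> 'rV[R]_d),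
    borel_oracle g ->
    (forall (t : nat) (x : 'rV[R]_d) (i : 'I_d),
       P.-integrable [set: Omega] (fun w => (g x (xi t w) 0 i)%:E) /\
       ('E_P[fun w => (g x (xi t w) 0 i)%R] = (grad f x 0 i)%:E)%E) ->
    (forall (t : nat) (x : 'rV[R]_d),
       'E_P[fun w => (norm2 (g x (xi t w) - grad f x) ^+ 2)%R]
         <= (sigma ^+ 2 + C * norm2 (grad f x) ^+ 2)%:E)%E ->
    mutually_independent xi ->
    (\sum_(0 <= t <oo)
       ((gamma t)%:E *
        'E_P[fun w =>
               (norm2 (grad f (sum_iterate g beta s gamma x0
                                 (fun k => xi k w) t)) ^+ 2)%R])
     <= C0%:E)%E.
Proof.
have [df cgrad] := hf_C1; have [hal0 _] := andP halpha; have [hb0 hb1] := andP hbeta.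
have [fl f_ge] : exists fl, forall x, fl <= f x.
  have inf_le x : (ereal_inf (range (fun x => (f x)%:E)) <= (f x)%:E)%E.
    by apply: ereal_inf_lbound; exists x.
  case: (ereal_inf _) hf_inf inf_le => [r _ inf_le| _ inf_le|//].
    by exists r => x; rewrite -lee_fin.
  (* An infimum equal to [+oo] would contradict the finiteness of [f x0]. *)
  by have := inf_le x0; rewrite leye_eq.
pose q := (1 - beta)^-1.
have q0 : 0 < q by rewrite invr_gt0 subr_gt0.
have [B [D [B0 D0 drift]]] :=
  lyapunov_drift s sigma hbeta df f_ge halpha hA hf_hoelder hC.
have /choice[E growth] :=
  moment_growth x0 s sigma hbeta halpha hA hf_hoelder hC.
have [H [H0 grad_le lyap_le]] :=
  le_moment x0 hbeta df f_ge halpha hA hf_hoelder.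
(* Dividing by [B + 1] is safe even if [B = 0], and [B / (B + 1) <= 1] then gives the smallness
   condition of the drift. *)
have eps0 : 0 < q / 4 / (B + 1) by rewrite !divr_gt0// ltr_wpDl.
have [T small] := eventually_small_step hgamma_ge0 hal0 eps0 hgamma_sum.
pose a t := gamma t `^ (1 + alpha).
pose Abar := fine (\sum_(0 <= t <oo) (a t)%:E)%E.
pose M t := moment x0 beta (x0, x0) * \prod_(k < t) Num.max 0 (E (gamma k)).
(* Before [T] each gradient is bounded through the moment. From [T] on the drift telescopes:
   [H * M T] bounds its starting value, and [4 * (1 - beta)] is the inverse of the factor [q / 4] in
   front of [gamma t]. *)
exists (\sum_(0 <= t < T) gamma t * (H * M t) +
  4 * (1 - beta) * (H * M T + D * Abar)).
move=> dO dX Omega P Xi xi g mg unb var indep.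
have sample t x : oracle_sample f sigma C P (fun w => g x (xi t w)) x.
  split => [i|i|]; first exact: (unb t x i).1.
    by have := (unb t x i).2; rewrite unlock.
  by have := var t x; rewrite unlock.
pose S t w := sum_state g beta s gamma x0 (fun k => xi k w) t.
pose EN t := (\int[P]_w (norm2 (grad f (S t w).1) ^+ 2)%:E)%E.
pose EL t := (\int[P]_w (lyapunov f beta A fl (S t w))%:E)%E.
have EN0 t : (0 <= EN t)%E.
  by apply: integral_ge0 => w _; rewrite lee_fin sqr_ge0.
have EL0 t : (0 <= EL t)%E.
  by apply: integral_ge0 => w _; rewrite lee_fin lyapunov_ge0.
have momentE t : (\int[P]_w (moment x0 beta (S t w))%:E <= (M t)%:E)%E.
  apply: moment_process_le => // c X S' hX; exact: growth.
have le_HM (phi : 'rV[R]_d * 'rV[R]_d -> R) t :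
    measurable_fun [set: borel_rV R d * borel_rV R d]
      (phi : borel_rV R d * borel_rV R d -> R) ->
    (forall S, 0 <= phi S) -> (forall S, phi S <= H * moment x0 beta S) ->
    (\int[P]_w (phi (S t w))%:E <= (H * M t)%:E)%E.
  move=> mphi phi0 phi_le.
  have mM : measurable_fun setT (fun w => (moment x0 beta (S t w))%:E).
    exact: measurable_comp_sum_process (measurable_moment x0 beta).
  have M0 w : (0 <= (moment x0 beta (S t w))%:E)%E.
    by rewrite lee_fin; exact: le_trans (moment_ge1 _ _ _).
  apply: (@le_trans _ _ (\int[P]_w (H%:E * (moment x0 beta (S t w))%:E))%E).
    apply: ge0_le_integral => //.
    - by move=> w _; rewrite lee_fin.
    - exact: (measurable_comp_sum_process beta s gamma x0 mg t mphi).
    - exact: measurable_funeM.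
    - by move=> w _; rewrite -EFinM lee_fin.
  rewrite ge0_integralZl_EFin// EFinM.
  by apply: lee_wpmul2l; [rewrite lee_fin|exact: momentE].
have EN_le t : (EN t <= (H * M t)%:E)%E.
  apply: (le_HM (fun S => norm2 (grad f S.1) ^+ 2)) => //.
    exact: measurable_sqr_norm2_grad.
  by move=> ?; exact: sqr_ge0.
have EL_le t : (EL t <= (H * M t)%:E)%E.
  apply: (le_HM (lyapunov f beta A fl)) => //; first exact: measurable_lyapunov.
  by move=> ?; exact: lyapunov_ge0.
have step t : (T <= t)%N ->
    (EL t.+1 + (q * gamma t / 4)%:E * EN t <= EL t + (D * a t)%:E)%E.
  move=> /small[g1 ga]; apply: lyapunov_process_drift => //.
  - by rewrite divr_ge0// mulr_ge0// ltW.
  - by rewrite mulr_ge0// powR_ge0.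
  move=> S'; apply: drift => //.
  - by rewrite hgamma_ge0 g1.
  - apply: le_trans (ler_wpM2l B0 ga) _.
    rewrite [leLHS](_ : _ = B / (B + 1) * (q * gamma t / 4)); last by field; lra.
    rewrite ler_piMl//; first by rewrite divr_ge0// mulr_ge0// ltW.
    by rewrite ler_pdivrMr ?ltr_wpDl// mul1r lerDl.
  - exact: (@measurable_oracle_update R d dO dX Omega P Xi xi g beta s gamma mg
      (lyapunov f beta A fl) t S' (measurable_lyapunov _ _ _ df)).
have a0 t : (0 <= (a t)%:E)%E by rewrite lee_fin powR_ge0.
have Abar_fin : (\sum_(0 <= t <oo) (a t)%:E)%E \is a fin_num.
  by rewrite ge0_fin_numE// nneseries_ge0.
have late k : (\sum_(T <= t < T + k) (gamma t)%:E * EN t <=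
    (4 * (1 - beta) * (H * M T + D * Abar))%:E)%E.
  have b1 : 0 <= 4 * (1 - beta) by rewrite mulr_ge0// subr_ge0 ltW.
  have -> : (\sum_(T <= t < T + k) (gamma t)%:E * EN t =
      (4 * (1 - beta))%:E * \sum_(T <= t < T + k) (q * gamma t / 4)%:E * EN t)%E.
    rewrite ge0_sume_distrr; last first.
      by move=> t _; rewrite mule_ge0// lee_fin divr_ge0// mulr_ge0// ltW.
    apply: eq_bigr => t _; rewrite muleA -EFinM; congr (_%:E * _)%E.
    by rewrite /q; field; lra.
  rewrite [leRHS]EFinM; apply: lee_wpmul2l; first by rewrite lee_fin.
  apply: le_trans (le_trans (telescope_drift step k) _).
    by rewrite leeDr.
  rewrite EFinD; apply: leeD => //.
  under eq_bigr do rewrite EFinM.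
  rewrite -ge0_sume_distrr// EFinM; apply: lee_wpmul2l; first by rewrite lee_fin.
  rewrite /Abar fineK//; apply: le_trans (nneseries_lim_ge (T + k) _); last first.
    by move=> t _ _.
  rewrite [leRHS](big_cat_nat (n := T))//= ?leq_addr//.
  by rewrite leeDr// sume_ge0.
have gEN0 t : (0 <= (gamma t)%:E * EN t)%E by rewrite mule_ge0// lee_fin.
have ENE t : ('E_P[fun w => (norm2 (grad f
    (sum_iterate g beta s gamma x0 (fun k => xi k w) t)) ^+ 2)%R] = EN t)%E.
  by rewrite unlock.
apply: le_trans (lee_nneseries (v := fun t => ((gamma t)%:E * EN t)%E) _ _) _.
- by move=> t _ _; rewrite ENE; exact: gEN0.
- by move=> t _; rewrite ENE.
apply: lime_le; first exact: is_cvg_nneseries.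
apply: nearW => k.
(* Lengthening the partial sum to [T + k] allows the split at [T] even when [k < T]. *)
apply: (@le_trans _ _ (\sum_(0 <= t < T + k) (gamma t)%:E * EN t)%E).
  by apply: lee_sum_nneg_natr; rewrite ?leq_addl// => t _ _.
rewrite (big_cat_nat (n := T))//= ?leq_addr// EFinD; apply: leeD; last exact: late.
rewrite -sumEFin; apply: lee_sum => t _; rewrite EFinM.
by apply: lee_wpmul2l; rewrite ?lee_fin.
Qed.
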